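(* Let $a$ be the diameter (diagonal) and $b$ the side of a square. Then $a^2=2b^2$, $\mathrm{Anth}(a,b)=[1,2,2,2,\ldots]$ (an infinite sequence whose first term is $1$ and all of whose later terms are $2$), and $a$ and $b$ are incommensurable.
   Context: Lines are line segments, identified with their lengths, which are positive real numbers. The anthyphairesis of two lines $a>b$ is the process of successive reciprocal division (Euclidean algorithm): $a=k_0b+c_1$ with $c_1<b$, $b=k_1c_1+c_2$ with $c_2<c_1$, $c_1=k_2c_2+c_3$ with $c_3<c_2$, and so on, where the quotients $k_i$ are natural numbers and the remainders $c_i$ are lines. The process is finite if at some step a remainder exactly divides the preceding one (i.e. the next remainder would be $0$), in which case it stops after recording that quotient; otherwise it is infinite. $\mathrm{Anth}(a,b)=[k_0,k_1,k_2,\ldots]$ denotes the (finite or infinite) sequence of quotients. Two lines $a,b$ are commensurable if there are a line $c$ and positive integers $m,n$ with $a=mc$ and $b=nc$; otherwise they are incommensurable. *)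

(* Defs.v *)
From mathcomp Require Import all_boot all_order all_algebra.
From mathcomp Require Import reals.

Set Implicit Arguments.
Unset Strict Implicit.
Unset Printing Implicit Defensive.

Import Order.TTheory GRing.Theory Num.Theory.
Local Open Scope ring_scope.

Section EuclideanPlane.
Variable R : realType.
Implicit Types A B C D : 'rV[R]_2.

(* The norm that MathComp-Analysis puts on row vectors is the sup norm, hence
   the explicit Euclidean structure. *)
Definition dot (u v : 'rV[R]_2) : R := \sum_i u 0 i * v 0 i.

Definition dist A B : R := Num.sqrt (dot (B - A) (B - A)).

(* The angle ABC, with vertex B, is right. *)
Definition right_angle A B C : Prop := dot (A - B) (C - B) = 0.

(* Euclid, Elements I, Def. 22: a quadrilateral (vertices in cyclic order) that
   is both equilateral and right-angled; [A <> B] excludes the quadrilateral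
   reduced to a point. *)
Definition square A B C D : Prop :=
  [/\ A <> B,
      [/\ dist A B = dist B C, dist B C = dist C D & dist C D = dist D A] &
      [/\ right_angle D A B, right_angle A B C,
          right_angle B C D & right_angle C D A]].

End EuclideanPlane.

Section Anthyphairesis.
Variable R : realType.
Implicit Types a b c : R.

(* Division with remainder a = k b + c, 0 <= c < b; see [divisionP]. *)
Definition quotient a b : nat := Num.truncn (a / b).
Definition remainder a b : R := a - (quotient a b)%:R * b.

Lemma divisionP a b c (k : nat) : 0 < a -> 0 < b ->
  (a = k%:R * b + c /\ 0 <= c < b) <-> (k = quotient a b /\ c = remainder a b).
Proof.
move=> a0 b0; split=> [[-> /andP[c0 cb]]|[-> ->]].
  suff kE : quotient (k%:R * b + c) b = k by rewrite /remainder kE addrAC subrr add0r.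
  apply: truncn_def; rewrite ler_pdivlMr // ltr_pdivrMr // lerDl c0 /=.
  by rewrite -natr1 mulrDl mul1r ltrD2l.
have /andP[h1 h2] := truncn_itv (divr_ge0 (ltW a0) (ltW b0)).
rewrite /remainder addrC subrK; split=> //; apply/andP; split.
  by rewrite subr_ge0 -ler_pdivlMr.
by rewrite ltrBlDl -[X in _ + X]mul1r -mulrDl natr1 -ltr_pdivrMr.
Qed.

(* A finite or infinite sequence of quotients is encoded as a function
   [nat -> option nat]: a finite one takes the value [None] from its length on.
   Meaningful for 0 < b < a. *)
Fixpoint Anth a b (n : nat) : option nat :=
  if n is m.+1 then
    if remainder a b == 0 then None else Anth b (remainder a b) m
  else Some (quotient a b).

Definition commensurable a b : Prop :=
  exists (c : R) (m n : nat),
    [/\ 0 < c, (0 < m)%N, (0 < n)%N, a = m%:R * c & b = n%:R * c].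

Definition incommensurable a b : Prop := ~ commensurable a b.

End Anthyphairesis.

(* Main.v *)
(** The Pythagorean theorem in the triangle [ABC] gives [a^2 = 2 b^2].  The first
    division leaves [a - b], and the pair [(b, a - b)] satisfies
    [b^2 = 2 b (a - b) + (a - b)^2].  A pair [(x, y)] with [x^2 = 2 x y + y^2]
    has quotient 2, and [(y, x - 2 y)] satisfies the same equation, so the
    quotient 2 recurs forever.  A common measure would give [m^2 = 2 n^2], where
    the exponent of 2 is even on the left and odd on the right. *)

Require Import Defs.
From mathcomp Require Import all_boot all_order all_algebra.
From mathcomp Require Import reals.
From mathcomp Require Import ring lra.
Import Order.TTheory GRing.Theory Num.Theory.
Local Open Scope ring_scope.

Section EuclideanPlane.
Variable R : realType.
Implicit Types (A B C : 'rV[R]_2) (u : 'rV[R]_2).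

Lemma dot_ge0 u : 0 <= dot u u.
Proof. by apply: sumr_ge0 => i _; rewrite -expr2 sqr_ge0. Qed.

Lemma sqr_dist A B : dist A B ^+ 2 = dot (B - A) (B - A).
Proof. by rewrite sqr_sqrtr // dot_ge0. Qed.

Lemma dist_gt0 A B : A <> B -> 0 < dist A B.
Proof.
move=> AB; rewrite sqrtr_gt0 lt0r dot_ge0 andbT.
apply/eqP => /psumr_eq0P u0; apply: AB; apply/rowP => i; apply/eqP.
rewrite eq_sym -subr_eq0; have := u0 (fun j _ => _) i isT.
rewrite !mxE => /(_ _)/eqP; rewrite mulf_eq0 orbb; apply=> j.
by rewrite -expr2 sqr_ge0.
Qed.

(** In coordinates, [dist A C ^+ 2] is the sum of the other two squares minus twice
    [dot (A - B) (C - B)], which vanishes. *)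
Lemma pythagoras A B C :
  right_angle A B C -> dist A C ^+ 2 = dist A B ^+ 2 + dist B C ^+ 2.
Proof.
rewrite /right_angle !sqr_dist /dot !big_ord_recl !big_ord0 !mxE => h.
by lra.
Qed.

End EuclideanPlane.

Section Anthyphairesis.
Variable R : realType.
Implicit Types a b c x y : R.

(** The equation makes [x / y] the positive root [1 + sqrt 2] of [t^2 = 2 t + 1]. *)
Lemma Anth_silver_ratio x y (n : nat) :
  0 < x -> 0 < y -> x ^+ 2 = 2 * x * y + y ^+ 2 -> Anth x y n = Some 2%N.
Proof.
elim: n x y => [|n IHn] x y x0 y0 xy.
(* The equation reads [x * (x - 2 * y) = y ^+ 2], and the right side is positive. *)
all: have r0 : 0 < x - 2 * y by
  rewrite -(pmulr_rgt0 _ x0); have := mulr_gt0 y0 y0; lra.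
all: have ry : x - 2 * y < y by nra.
all: have [qE rE] : 2%N = quotient x y /\ x - 2 * y = remainder x y by
  apply/divisionP => //; split; [ring | rewrite (ltW r0)].
- by rewrite /= -qE.
- rewrite /= -rE gt_eqF //; apply: IHn => //; ring: xy.
Qed.

Lemma Anth_sqrt2 a b (n : nat) : 0 < a -> 0 < b -> a ^+ 2 = 2 * b ^+ 2 ->
  Anth a b n = Some (if n == 0%N then 1%N else 2%N).
Proof.
move=> a0 b0 ab.
(* The quotient is 1 because [b ^+ 2 < a ^+ 2 < (2 * b) ^+ 2]. *)
have r0 : 0 < a - b by nra.
have rb : a - b < b by nra.
have [qE rE] : 1%N = quotient a b /\ a - b = remainder a b
  by apply/divisionP => //; split; [ring | rewrite (ltW r0)].
case: n => [|n] /=; first by rewrite -qE.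
by rewrite -rE gt_eqF //; apply: Anth_silver_ratio => //; ring: ab.
Qed.

Lemma incommensurable_sqrt2 a b : a ^+ 2 = 2 * b ^+ 2 -> incommensurable a b.
Proof.
move=> ab [c [m [n [c0 m0 n0 aE bE]]]].
have mn : (m ^ 2 = 2 * n ^ 2)%N.
  move: ab; rewrite aE bE !exprMn [2 * _]mulrA.
  move/(mulIf (lt0r_neq0 (exprn_gt0 2 c0)))/eqP.
  by rewrite -!natrX -natrM eqr_nat => /eqP.
have := congr1 (odd \o logn 2) mn.
by rewrite /= lognM ?expn_gt0 ?n0 // !lognX oddD !oddM.
Qed.

End Anthyphairesis.

Theorem mainTheorem1 (R : realType) (A B C D : 'rV[R]_2) (a b : R)
    (hsquare : square A B C D) (ha : a = dist A C) (hb : b = dist A B) :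
  [/\ a ^+ 2 = 2 * b ^+ 2,
      forall n : nat, Anth a b n = Some (if n == 0%N then 1%N else 2%N) &
      incommensurable a b].
Proof.
have [AB [dBC _ _] [_ rB _ _]] := hsquare.
have b0 : 0 < b by rewrite hb dist_gt0.
have ab : a ^+ 2 = 2 * b ^+ 2.
  by rewrite ha (pythagoras _ _ _ _ rB) -dBC -hb mulr2n mulrDl !mul1r.
have a0 : 0 < a.
  have : 0 <= a by rewrite ha sqrtr_ge0.
  (* [a = 0] would force [b ^+ 2 = 0]. *)
  by rewrite le0r => /predU1P[a0|//]; move: ab; nra.
split=> [//|n|]; first exact: Anth_sqrt2.
exact: incommensurable_sqrt2.
Qed.
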